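(* Let $u$ be a bivariate linear functional, $L^{(1)},L^{(2)}$ nonzero Laurent polynomials $L^{(a)}(z)=L^{(a)}_nz^n+\dots+L^{(a)}_{-m}z^{-m}$ with $L^{(a)}_nL^{(a)}_{-m}\neq0$, $n,m\in\{0,1,2,\dots\}$, and let $\hat u^{(1)}=L^{(1)}(z_1)u$, $\hat u^{(2)}=u\,\overline{L^{(2)}(z_2)}$, where the Gram matrices $G,\hat G^{(1)},\hat G^{(2)}$ are quasidefinite. With the connectors $$\omega^{(1)}_1=\hat S^{(1)}_1L^{(1)}(\Upsilon)S_1^{-1},\quad\omega^{(1)}_2=S_2(\hat S^{(1)}_2)^{-1},\quad\omega^{(2)}_1=S_1(\hat S^{(2)}_1)^{-1},\quad\omega^{(2)}_2=\hat S^{(2)}_2L^{(2)}(\Upsilon)S_2^{-1},$$ the following connection formulas hold: $$\omega^{(1)}_1\phi_1(z)=L^{(1)}(z)\hat\phi^{(1)}_1(z),\qquad\omega^{(1)}_2\hat\phi^{(1)}_2(z)=\phi_2(z),$$ $$\omega^{(2)}_1\hat\phi^{(2)}_1(z)=\phi_1(z),\qquad\omega^{(2)}_2\phi_2(z)=L^{(2)}(z)\hat\phi^{(2)}_2(z).$$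
   Context: Indices start at $0$. CMV sequence: $\chi(z)=[1,z^{-1},z,z^{-2},z^2,\dots]^\top$. $\Upsilon$ is the semi-infinite permutation matrix with $\Upsilon\chi(z)=z\chi(z)$, i.e. its nonzero entries, all equal to $1$, are $\Upsilon_{2k,2k+2}$, $\Upsilon_{1,0}$, $\Upsilon_{2k+3,2k+1}$ ($k\ge0$); $\Upsilon^{-1}=\Upsilon^\top$, and $L(\Upsilon)=\sum_jL_j\Upsilon^j$. A bivariate linear functional $u=u_{z_1,\bar z_2}$ is a (continuous) linear functional on the span of $f(z_1)\otimes\overline{g(z_2)}:=f(z_1)\overline{g(z_2)}$, $f,g\in\mathbb C[z,z^{-1}]$; $\langle f,g\rangle_u=\langle u,f(z_1)\otimes\overline{g(z_2)}\rangle$; Gram matrix $G_{k,l}=\langle\chi^{(k)},\chi^{(l)}\rangle_u$. Quasidefinite means all leading principal minors are nonzero; then $G=S_1^{-1}H(S_2^{-1})^\dagger$ uniquely with $S_1,S_2$ lower unitriangular and $H$ diagonal with nonzero entries, and $\phi_a(z)=S_a\chi(z)$, $a=1,2$. The perturbed functionals are $\langle\hat u^{(1)},f\otimes\bar g\rangle=\langle u,L^{(1)}f\otimes\bar g\rangle$, $\langle\hat u^{(2)},f\otimes\bar g\rangle=\langle u,f\otimes\overline{L^{(2)}g}\rangle$, with Gram matrices $\hat G^{(a)}=(\hat S^{(a)}_1)^{-1}\hat H^{(a)}\big((\hat S^{(a)}_2)^{-1}\big)^\dagger$ factorized in the same way and $\hat\phi^{(a)}_b(z)=\hat S^{(a)}_b\chi(z)$,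 $b=1,2$. *)

(* Defs.v *)
From HB Require Import structures.
From mathcomp Require Import all_boot all_order all_algebra.
From mathcomp Require Import finmap.
From mathcomp Require Import boolp classical_sets functions fsbigop reals.
From mathcomp Require Import complex monalg.

Set Implicit Arguments.
Unset Strict Implicit.
Unset Printing Implicit Defensive.

Import Order.TTheory GRing.Theory Num.Theory.

Local Open Scope ring_scope.

Definition smx (C : Type) := nat -> nat -> C.

Section SemiInfinite.
Variable C : numClosedFieldType.
Implicit Types A B : smx C.

(* The sum over all k is 0 when infinitely many terms are nonzero. Every product
   formed below has a row-finite left factor or a column-finite right factor, so
   that its sums are finite. *)
Definition smx_mul A B : smx C :=
  fun i j => \sum_(k \in [set: nat]) A i k * B k j.

(* Same convention; A is row-finite whenever this is used. *)
Definition smx_act (V : lmodType C) A (v : nat -> V) : nat -> V :=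
  fun i => \sum_(k \in [set: nat]) A i k *: v k.

Definition smx_one : smx C := fun i j => (i == j)%:R.

Definition smx_diag (h : nat -> C) : smx C := fun i j => h i *+ (i == j).

Definition smx_tr A : smx C := fun i j => A j i.

Definition smx_dagger A : smx C := fun i j => (A j i)^*.

Definition smx_exp A (n : nat) : smx C := iter n (smx_mul A) smx_one.

Definition lower_unitriangular A : Prop :=
  (forall i j : nat, (i < j)%N -> A i j = 0) /\ (forall i : nat, A i i = 1).

(* A chosen two-sided inverse, 0 if there is none. A lower unitriangular matrix
   has exactly one, which is again lower unitriangular. *)
Definition smx_inv A : smx C :=
  xget (fun=> fun=> 0)
    [set B | smx_mul A B = smx_one /\ smx_mul B A = smx_one].

Definition quasidefinite A : Prop :=
  forall n : nat, \det (\matrix_(i < n.+1, j < n.+1) A i j) != 0.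

Definition gauss_borel A (S1 : smx C) (h : nat -> C) (S2 : smx C) : Prop :=
  [/\ lower_unitriangular S1, lower_unitriangular S2,
      forall k, h k != 0 &
      A = smx_mul (smx_mul (smx_inv S1) (smx_diag h)) (smx_dagger (smx_inv S2))].

End SemiInfinite.

Section Laurent.
Variable C : numClosedFieldType.

(* Finitely supported coefficient families: f@_i is the coefficient of z^i, and
   << c *g i >> is the monomial c z^i. The monoid-algebra product of the library
   needs a monoid of exponents without nontrivial units, hence [laurent_mul]. *)
Definition laurent := {malg C[int]}.

(* The coefficient at (i, j) is that of z_1^i conj(z_2)^j. *)
Definition bilaurent := {malg C[(int * int)%type]}.

Definition laurent_mul (f g : laurent) : laurent :=
  \sum_(i <- msupp f) \sum_(j <- msupp g) << f@_i * g@_j *g (i + j) >>.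

(* f(z_1) conj(g(z_2)) *)
Definition tensor_conj (f g : laurent) : bilaurent :=
  \sum_(i <- msupp f) \sum_(j <- msupp g) << f@_i * (g@_j)^* *g (i, j) >>.

Definition laurent_range (L : laurent) (n m : nat) : Prop :=
  [/\ L@_(n%:Z) != 0, L@_(- m%:Z) != 0 &
      forall j : int, L@_j != 0 -> - m%:Z <= j <= n%:Z].

(* [Negz k] is -(k+1): the exponents are 0, -1, 1, -2, 2, ... *)
Definition cmv_exponent (k : nat) : int :=
  if odd k then Negz k./2 else Posz k./2.

Definition cmv (k : nat) : laurent := << 1 *g cmv_exponent k >>.

Definition upsilon : smx C := fun i j =>
  ([|| ~~ odd i && (j == i.+2), (i == 1%N) && (j == 0%N)
     | odd j && (i == j.+2)])%:R.

(* [Negz n] is the exponent -(n+1), and the transpose of upsilon is its inverse. *)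
Definition upsilon_exp (j : int) : smx C :=
  match j with
  | Posz n => smx_exp upsilon n
  | Negz n => smx_exp (smx_tr upsilon) n.+1
  end.

Definition laurent_upsilon (L : laurent) : smx C :=
  fun k l => \sum_(j <- msupp L) L@_j * upsilon_exp j k l.

Definition functional := {scalar bilaurent}.

Definition gram (u : functional) : smx C :=
  fun k l => u (tensor_conj (cmv k) (cmv l)).

(* The elements f(z_1) conj(g(z_2)) span [bilaurent], so each of the next two
   conditions determines uh. *)
Definition left_perturbation (L : laurent) (u uh : functional) : Prop :=
  forall f g, uh (tensor_conj f g) = u (tensor_conj (laurent_mul L f) g).

Definition right_perturbation (L : laurent) (u uh : functional) : Prop :=
  forall f g, uh (tensor_conj f g) = u (tensor_conj f (laurent_mul L g)).

Definition biorthogonal_laurent (S : smx C) : nat -> laurent := smx_act S cmv.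

End Laurent.

(* Main.v *)
Require Import Defs.
From HB Require Import structures.
From mathcomp Require Import all_boot all_order all_algebra.
From mathcomp Require Import finmap.
From mathcomp Require Import boolp classical_sets functions fsbigop reals.
From mathcomp Require Import complex monalg.

Import Order.TTheory GRing.Theory Num.Theory.
Local Open Scope ring_scope.

Set Implicit Arguments.
Unset Strict Implicit.
Unset Printing Implicit Defensive.

(** The four formulas are pure linear algebra of semi-infinite matrices. Write
    [phi = S chi] with [chi] the CMV sequence. Since a lower unitriangular [S]
    has an inverse, the connector [S (Sh)^-1] sends [Sh chi] to [S chi], which
    is the second and third formulas. For the other two, the basic fact is that
    [L(Upsilon) chi = L chi] ([smx_act_laurent_upsilon]): [Upsilon] shifts the
    exponents of the CMV sequence by one ([cmv_exponent_succ]), hence its powers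
    multiply [chi] by powers of z. Then
    [Sh L(Upsilon) S^-1 S chi = Sh L(Upsilon) chi = Sh (L chi) = L (Sh chi)].
    The factorizations of the Gram matrices enter through the lower
    unitriangularity of the matrices S.

    The care needed is in reassociating products of infinite matrices and in
    inverting them. Both are controlled by row-finiteness: products of
    row-finite matrices may be applied in succession to any sequence
    ([smx_act_mul]), and a lower unitriangular matrix has a unique two-sided
    inverse, which is again lower unitriangular, so that [smx_inv] is
    row-finite and does invert ([smx_inv_unitriangular]). *)

(** * Row-finite semi-infinite matrices *)

Section RowFinite.
Variable C : numClosedFieldType.
Implicit Types A B : smx C.

Definition row_finite A : Prop :=
  forall i, exists n, forall k, (n <= k)%N -> A i k = 0.

Lemma fsum_nat_trunc (V : nmodType) (n : nat) (F : nat -> V) :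
  (forall k, (n <= k)%N -> F k = 0) ->
  \sum_(k \in [set: nat]) F k = \sum_(k < n) F k.
Proof.
move=> F0; rewrite fsbig_ord; apply/esym/fsbig_widen => // k [_ /negP].
by rewrite -leqNgt => /F0.
Qed.

Lemma smx_act_trunc (V : lmodType C) A (v : nat -> V) (i n : nat) :
  (forall k, (n <= k)%N -> A i k = 0) ->
  smx_act A v i = \sum_(k < n) A i k *: v k.
Proof.
by move=> A0; apply: fsum_nat_trunc => k /A0 ->; rewrite scale0r.
Qed.

Lemma smx_mul_trunc A B (i j n : nat) :
  (forall k, (n <= k)%N -> A i k = 0) ->
  smx_mul A B i j = \sum_(k < n) A i k * B k j.
Proof. by move=> A0; apply: fsum_nat_trunc => k /A0 ->; rewrite mul0r. Qed.

Lemma row_finite_bound B (n : nat) : row_finite B ->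
  exists m, forall i k, (i < n)%N -> (m <= k)%N -> B i k = 0.
Proof.
move=> /choice[b Bb]; exists (\max_(i < n) b i) => i k lt_in le_bk.
by apply: Bb; apply: leq_trans le_bk; apply: (leq_bigmax (Ordinal lt_in)).
Qed.

Lemma row_finite_mul A B :
  row_finite A -> row_finite B -> row_finite (smx_mul A B).
Proof.
move=> fA fB i; have [n An] := fA i; have [m Bm] := row_finite_bound n fB.
exists m => k le_mk; rewrite (smx_mul_trunc _ _ An) big1 // => l _.
by rewrite Bm ?mulr0.
Qed.

Lemma smx_act_mul (V : lmodType C) A B (v : nat -> V) :
  row_finite A -> row_finite B ->
  smx_act (smx_mul A B) v = smx_act A (smx_act B v).
Proof.
move=> fA fB; apply/funext => i; have [n An] := fA i.
have [m Bm] := row_finite_bound n fB.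
have ABm k : (m <= k)%N -> smx_mul A B i k = 0.
  by move=> le_mk; rewrite (smx_mul_trunc _ _ An) big1 // => l _; rewrite Bm ?mulr0.
rewrite (smx_act_trunc _ ABm) (smx_act_trunc _ An).
under eq_bigr do rewrite (smx_mul_trunc _ _ An) scaler_suml.
rewrite exchange_big; apply: eq_bigr => k _.
rewrite (@smx_act_trunc _ B v k m) ?scaler_sumr; last by move=> l; apply: Bm.
by apply: eq_bigr => l _; rewrite scalerA.
Qed.

(* A column of a matrix product is an action on a sequence of scalars. *)
Lemma smx_mulA A B (D : smx C) : row_finite A -> row_finite B ->
  smx_mul (smx_mul A B) D = smx_mul A (smx_mul B D).
Proof.
move=> fA fB; apply/funext => i; apply/funext => j.
have E := @smx_act_mul C^o A B (fun k => D k j) fA fB.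
exact: (congr1 (fun w => w i) E).
Qed.

(** [Upsilon], its inverse and their powers are of this form, on which products
    are compositions and the action on a sequence is a reindexing. *)
Definition relabel_smx (s : nat -> nat) : smx C := fun i j => (j == s i)%:R.

Lemma row_finite_relabel s : row_finite (relabel_smx s).
Proof.
move=> i; exists (s i).+1 => k lt_sk.
by rewrite /relabel_smx; case: eqP lt_sk => // ->; rewrite ltnn.
Qed.

Lemma smx_act_relabel (V : lmodType C) s (v : nat -> V) :
  smx_act (relabel_smx s) v = v \o s.
Proof.
apply/funext => i; rewrite (@smx_act_trunc _ _ v i (s i).+1); last first.
  by move=> k lt_sk; rewrite /relabel_smx; case: eqP lt_sk => // ->; rewrite ltnn.
rewrite big_ord_recr /= big1 ?add0r /relabel_smx ?eqxx ?scale1r // => k _.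
by rewrite ltn_eqF ?scale0r ?ltn_ord.
Qed.

Lemma smx_one_relabel : smx_one C = relabel_smx id.
Proof. by apply/funext=> i; apply/funext=> j; rewrite /relabel_smx eq_sym. Qed.

Lemma smx_mul_relabel s t :
  smx_mul (relabel_smx s) (relabel_smx t) = relabel_smx (t \o s).
Proof.
apply/funext => i; apply/funext => j.
have E := @smx_act_relabel C^o s (fun k => relabel_smx t k j).
exact: (congr1 (fun w => w i) E).
Qed.

Lemma smx_exp_relabel s n :
  smx_exp (relabel_smx s) n = relabel_smx (iter n s).
Proof.
elim: n => [|n IHn]; first exact: smx_one_relabel.
rewrite /smx_exp iterS -/(smx_exp _ n) IHn smx_mul_relabel.
by congr relabel_smx; apply/funext => i /=; rewrite -iterSr.
Qed.

Lemma smx_mul1 A : smx_mul (smx_one C) A = A.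
Proof.
apply/funext => i; apply/funext => j; rewrite smx_one_relabel.
exact: (congr1 (fun w => w i) (@smx_act_relabel C^o id (fun k => A k j))).
Qed.

Lemma smx_mulr1 A : row_finite A -> smx_mul A (smx_one C) = A.
Proof.
move=> fA; apply/funext => i; apply/funext => j; have [n An] := fA i.
have Am k : (maxn n j.+1 <= k)%N -> A i k = 0.
  by rewrite geq_max => /andP[/An].
rewrite (smx_mul_trunc _ _ Am).
have lt_j : (j < maxn n j.+1)%N by rewrite leq_max ltnSn orbT.
rewrite (bigD1 (Ordinal lt_j)) //= /smx_one eqxx mulr1 big1 ?addr0 // => k.
by rewrite -val_eqE /= => /negPf ->; rewrite mulr0.
Qed.

End RowFinite.

(** * Inverses of lower unitriangular matrices *)

Section Unitriangular.
Variable C : numClosedFieldType.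
Implicit Types S T : smx C.

Lemma row_finite_unitriangular S : lower_unitriangular S -> row_finite S.
Proof. by case=> S0 _ i; exists i.+1 => k; apply: S0. Qed.

Lemma smx_mul_unitriangular S T (i j : nat) : lower_unitriangular S ->
  smx_mul S T i j = \sum_(k < i) S i k * T k j + T i j.
Proof.
case=> S0 S1; rewrite (@smx_mul_trunc _ S T i j i.+1) => [|k]; last exact: S0.
by rewrite big_ord_recr /= S1 mul1r.
Qed.

(** Forward substitution: row i of [S T = 1] expresses row i of T through its
    earlier rows. Iterating this i + 1 times from any matrix settles row i. *)
Lemma unitriangular_right_inverse S : lower_unitriangular S ->
  exists2 T, lower_unitriangular T & smx_mul S T = smx_one C.
Proof.
move=> uS.
pose step T : smx C := fun i j => smx_one C i j - \sum_(k < i) S i k * T k j.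
pose T : smx C := fun i j => iter i.+1 step (fun=> fun=> 0) i j.
have stable n m i j : (i < n)%N -> (i < m)%N ->
    iter n step (fun=> fun=> 0) i j = iter m step (fun=> fun=> 0) i j.
  elim: n m i => // n IHn [//|m] i; rewrite !ltnS => le_in le_im /=.
  congr (_ - _); apply: eq_bigr => k _; congr (_ * _).
  by apply: IHn; apply: leq_trans (ltn_ord k) _.
have TE i j : T i j = smx_one C i j - \sum_(k < i) S i k * T k j.
  rewrite {1}/T iterS {1}/step; congr (_ - _); apply: eq_bigr => k _.
  by congr (_ * _); apply: stable.
have T0 i j : (i < j)%N -> T i j = 0.
  elim/ltn_ind: i => i IHi lt_ij; rewrite TE /smx_one ltn_eqF // big1 ?subr0 //.
  by move=> k _; rewrite IHi ?mulr0 // (ltn_trans _ lt_ij).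
exists T; first split=> // i.
  by rewrite TE /smx_one eqxx big1 ?subr0 // => k _; rewrite T0 ?mulr0.
apply/funext => i; apply/funext => j.
by rewrite smx_mul_unitriangular // TE addrC subrK.
Qed.

(** The right inverse T of S has itself a right inverse, which can only be S;
    so T is two-sided, and any other inverse B equals [(T S) B = T (S B) = T]. *)
Lemma smx_inv_unitriangular S : lower_unitriangular S ->
  lower_unitriangular (smx_inv S) /\ smx_mul (smx_inv S) S = smx_one C.
Proof.
move=> uS; have [T uT ST] := unitriangular_right_inverse uS.
have [U _ TU] := unitriangular_right_inverse uT.
have [fS fT] := (row_finite_unitriangular uS, row_finite_unitriangular uT).
have TS : smx_mul T S = smx_one C.
  suff -> : S = U by [].
  by rewrite -(smx_mulr1 fS) -TU -smx_mulA // ST smx_mul1.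
suff -> : smx_inv S = T by [].
rewrite /smx_inv; case: xgetP => [B _ [SB _]|/(_ T)/= []//].
by rewrite -[B]smx_mul1 -TS smx_mulA // SB smx_mulr1.
Qed.

Lemma row_finite_inv S : lower_unitriangular S -> row_finite (smx_inv S).
Proof. by case/smx_inv_unitriangular => /row_finite_unitriangular. Qed.

Lemma smx_act_invK (V : lmodType C) S (v : nat -> V) : lower_unitriangular S ->
  smx_act (smx_inv S) (smx_act S v) = v.
Proof.
move=> uS; rewrite -smx_act_mul; first last.
- exact: row_finite_unitriangular.
- exact: row_finite_inv.
have [_ ->] := smx_inv_unitriangular uS.
by rewrite smx_one_relabel smx_act_relabel.
Qed.

End Unitriangular.

(** * Multiplication of Laurent polynomials *)

Section Laurent.
Variable C : numClosedFieldType.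
Implicit Types f g : laurent C.

Lemma laurent_mul_widen f g (d : {fset int}) : (msupp g `<=` d)%fset ->
  laurent_mul f g =
  \sum_(i <- msupp f) \sum_(j <- d) << f@_i * g@_j *g (i + j) >>.
Proof.
move=> gd; apply: eq_bigr => i _; apply: big_fset_incl gd _ => j _ /mcoeff_outdom.
by move=> ->; rewrite mulr0 monalgU0.
Qed.

Lemma laurent_mul_linear f (c : C) g1 g2 :
  laurent_mul f (c *: g1 + g2) = c *: laurent_mul f g1 + laurent_mul f g2.
Proof.
pose d := (msupp g1 `|` msupp g2)%fset.
have d1 : (msupp g1 `<=` d)%fset by apply: fsubsetUl.
have d2 : (msupp g2 `<=` d)%fset by apply: fsubsetUr.
have d12 : (msupp (c *: g1 + g2)%R `<=` d)%fset.
  apply: fsubset_trans (msuppD_le _ _) _.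
  by apply: fsetSU; apply: msuppZ_le.
rewrite (laurent_mul_widen f d12) (laurent_mul_widen f d1).
rewrite (laurent_mul_widen f d2) scaler_sumr -big_split; apply: eq_bigr => i _.
rewrite scaler_sumr -big_split; apply: eq_bigr => j _ /=.
apply/malgP => k; rewrite !(mcoeffD, mcoeffZ, mcoeffU).
by rewrite mulrDr mulrnDl mulrnAr mulrCA.
Qed.

HB.instance Definition _ f :=
  GRing.isLinear.Build C (laurent C) (laurent C) _ (laurent_mul f)
    (laurent_mul_linear f).

Lemma laurent_mulU f (n : int) :
  laurent_mul f << 1 *g n >> = \sum_(i <- msupp f) f@_i *: << 1 *g i + n >>.
Proof.
apply: eq_bigr => i _; rewrite msuppU oner_eq0 big_seq_fset1 mcoeffUU mulr1.
apply/malgP => k; by rewrite mcoeffZ !mcoeffU mulrnAr mulr1.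
Qed.

(** Multiplication by f is linear and each entry of the action is a finite sum. *)
Lemma smx_act_laurent_mul (A : smx C) f (v : nat -> laurent C) : row_finite A ->
  smx_act A (fun k => laurent_mul f (v k)) =
  (fun k => laurent_mul f (smx_act A v k)).
Proof.
move=> fA; apply/funext => i; have [n An] := fA i.
rewrite !(smx_act_trunc _ An) linear_sum; apply: eq_bigr => k _.
by rewrite linearZ.
Qed.

End Laurent.

(** * The shift matrix and the CMV sequence *)

Section Upsilon.
Variable C : numClosedFieldType.

(** The index of z times the k-th CMV monomial, and of z^-1 times it: along
    0, -1, 1, -2, 2, ... the nonnegative exponents sit at the even positions
    and the negative ones at the odd positions. *)
Definition cmv_succ (k : nat) : nat :=
  if odd k then if k == 1%N then 0%N else k.-2 else k.+2.
Definition cmv_pred (k : nat) : nat :=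
  if odd k then k.+2 else if k == 0%N then 1%N else k.-2.

Lemma upsilon_relabel : upsilon C = relabel_smx C cmv_succ.
Proof.
apply/funext => i; apply/funext => j; rewrite /upsilon /relabel_smx; congr (_%:R).
rewrite /cmv_succ; case: i => [|[|i]] //=; rewrite ?andbF ?orbF //.
rewrite !eqSS !negbK; case: (boolP (odd i)) => oi /=.
  by rewrite eq_sym; case: eqP => [->|_]; rewrite ?oi ?andbF.
by case: (i =P j) => [<-|_]; rewrite ?(negbTE oi) ?andbF orbF.
Qed.

Lemma tr_upsilon_relabel : smx_tr (upsilon C) = relabel_smx C cmv_pred.
Proof.
apply/funext => i; apply/funext => j.
rewrite /smx_tr /upsilon /relabel_smx; congr (_%:R); rewrite /cmv_pred.
case: i => [|[|i]] //=; rewrite ?andbF ?andbT ?orbF ?eqSS //=.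
rewrite !negbK; case: (boolP (odd i)) => oi /=; rewrite ?orbF [i == j]eq_sym.
  by case: eqP => [->|_]; rewrite ?oi ?andbF.
by case: eqP => [->|_]; rewrite ?oi ?andbF.
Qed.

Lemma cmv_exponent_SS k :
  cmv_exponent k.+2 = cmv_exponent k + (if odd k then -1 else 1).
Proof.
rewrite /cmv_exponent /= negbK; case: (odd k); last by rewrite -PoszD addn1.
by rewrite !NegzE -opprD -PoszD addn1.
Qed.

Lemma cmv_exponent_succ k : cmv_exponent (cmv_succ k) = 1 + cmv_exponent k.
Proof.
rewrite /cmv_succ; case: k => [|[|k]] //=; rewrite negbK.
by case: (boolP (odd k)) => ok; rewrite !cmv_exponent_SS /= ?ok ?(negbTE ok) 1?addrC
  ?negbK ?(negbTE ok) ?ok // addrK.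
Qed.

Lemma cmv_exponent_pred k : cmv_exponent (cmv_pred k) = -1 + cmv_exponent k.
Proof.
rewrite /cmv_pred; case: k => [|[|k]] //=; rewrite negbK.
by case: (boolP (odd k)) => ok; rewrite !cmv_exponent_SS /= ?ok ?(negbTE ok) 1?addrC
  ?negbK ?(negbTE ok) ?ok // addrK.
Qed.

Lemma upsilon_exp_relabel (n : int) :
  exists2 s, upsilon_exp C n = relabel_smx C s &
             forall k, cmv_exponent (s k) = n + cmv_exponent k.
Proof.
have shift a s : (forall k, cmv_exponent (s k) = a + cmv_exponent k) ->
    forall m k, cmv_exponent (iter m s k) = a *+ m + cmv_exponent k.
  by move=> sE; elim=> [|m IHm] k; rewrite ?add0r //= sE IHm addrA -mulrS.
case: n => n; rewrite /upsilon_exp.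
  exists (iter n cmv_succ); first by rewrite upsilon_relabel smx_exp_relabel.
  by move=> k; rewrite (shift _ _ cmv_exponent_succ) natz.
exists (iter n.+1 cmv_pred); first by rewrite tr_upsilon_relabel smx_exp_relabel.
by move=> k; rewrite (shift _ _ cmv_exponent_pred) NegzE mulNrn natz.
Qed.

Lemma upsilon_exp_row_bound (r : seq int) i :
  exists b, forall n k, n \in r -> (b <= k)%N -> upsilon_exp C n i k = 0.
Proof.
elim: r => [|n r [b Hb]]; first by exists 0%N.
have [s sE _] := upsilon_exp_relabel n.
have [a Ha] := row_finite_relabel C s i.
exists (maxn a b) => m k; rewrite inE geq_max => mr /andP[ak bk].
by case/orP: mr => [/eqP ->|mr]; [rewrite sE Ha | apply: Hb].
Qed.

Lemma row_finite_laurent_upsilon (L : laurent C) :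
  row_finite (laurent_upsilon L).
Proof.
move=> i; have [b Hb] := upsilon_exp_row_bound (msupp L) i.
exists b => k bk; rewrite /laurent_upsilon big_seq big1 // => n nL.
by rewrite Hb ?mulr0.
Qed.

(** The n-th power of Upsilon multiplies every CMV monomial by z^n, and L(Upsilon)
    and L combine these powers with the same coefficients. *)
Lemma smx_act_laurent_upsilon (L : laurent C) :
  smx_act (laurent_upsilon L) (@cmv C) = (fun k => laurent_mul L (cmv C k)).
Proof.
apply/funext => i; rewrite laurent_mulU.
(* The bound serves row i of L(Upsilon) and of every power of Upsilon in it. *)
have [b Hb] := upsilon_exp_row_bound (msupp L) i.
rewrite (@smx_act_trunc _ _ _ _ i b) => [|k bk]; last first.
  by rewrite /laurent_upsilon big_seq big1 // => n nL; rewrite Hb ?mulr0.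
under eq_bigr do rewrite scaler_suml.
rewrite exchange_big big_seq [RHS]big_seq; apply: eq_bigr => n nL.
have [s sE sn] := upsilon_exp_relabel n.
under eq_bigr do rewrite -scalerA.
rewrite -scaler_sumr -(@smx_act_trunc _ _ _ (@cmv C) i b (Hb n ^~ nL)).
by rewrite sE smx_act_relabel /= /cmv sn.
Qed.

End Upsilon.

(** * Connection formulas *)

Section Connection.
Variable C : numClosedFieldType.
Implicit Types S Sh : smx C.

Lemma connector_act (V : lmodType C) S Sh (v : nat -> V) :
  lower_unitriangular S -> lower_unitriangular Sh ->
  smx_act (smx_mul S (smx_inv Sh)) (smx_act Sh v) = smx_act S v.
Proof.
move=> uS uSh; rewrite smx_act_mul ?smx_act_invK //.
- exact: row_finite_unitriangular.
- exact: row_finite_inv.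
Qed.

Lemma laurent_connector_act (L : laurent C) S Sh :
  lower_unitriangular S -> lower_unitriangular Sh ->
  smx_act (smx_mul (smx_mul Sh (laurent_upsilon L)) (smx_inv S))
    (biorthogonal_laurent S) =
  (fun k => laurent_mul L (biorthogonal_laurent Sh k)).
Proof.
move=> uS uSh; have fSh := row_finite_unitriangular uSh.
have fL := row_finite_laurent_upsilon L.
rewrite smx_act_mul ?smx_act_invK //; first last.
- exact: row_finite_inv.
- exact: row_finite_mul.
by rewrite smx_act_mul // smx_act_laurent_upsilon smx_act_laurent_mul.
Qed.

End Connection.

Theorem proposition10 (R : realType) (u uh1 uh2 : functional R[i])
  (L1 L2 : laurent R[i]) (n1 m1 n2 m2 : nat)
  (S1 S2 Sh11 Sh12 Sh21 Sh22 : smx R[i]) (h hh1 hh2 : nat -> R[i]) :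
  laurent_range L1 n1 m1 ->
  laurent_range L2 n2 m2 ->
  left_perturbation L1 u uh1 ->
  right_perturbation L2 u uh2 ->
  quasidefinite (gram u) ->
  quasidefinite (gram uh1) ->
  quasidefinite (gram uh2) ->
  gauss_borel (gram u) S1 h S2 ->
  gauss_borel (gram uh1) Sh11 hh1 Sh12 ->
  gauss_borel (gram uh2) Sh21 hh2 Sh22 ->
  let phi1 := biorthogonal_laurent S1 in
  let phi2 := biorthogonal_laurent S2 in
  let phih11 := biorthogonal_laurent Sh11 in
  let phih12 := biorthogonal_laurent Sh12 in
  let phih21 := biorthogonal_laurent Sh21 in
  let phih22 := biorthogonal_laurent Sh22 in
  let omega11 := smx_mul (smx_mul Sh11 (laurent_upsilon L1)) (smx_inv S1) in
  let omega12 := smx_mul S2 (smx_inv Sh12) in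
  let omega21 := smx_mul S1 (smx_inv Sh21) in
  let omega22 := smx_mul (smx_mul Sh22 (laurent_upsilon L2)) (smx_inv S2) in
  [/\ smx_act omega11 phi1 = (fun k => laurent_mul L1 (phih11 k)),
      smx_act omega12 phih12 = phi2,
      smx_act omega21 phih21 = phi1 &
      smx_act omega22 phi2 = (fun k => laurent_mul L2 (phih22 k))].
Proof.
move=> _ _ _ _ _ _ _ [uS1 uS2 _ _] [uSh11 uSh12 _ _] [uSh21 uSh22 _ _] *.
by split; [exact: laurent_connector_act | exact: connector_act
  | exact: connector_act | exact: laurent_connector_act].
Qed.
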